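(* Let $(X_i,\omega_i)$, $i=0,\dots,k$, be compact Kähler manifolds of complex dimension $n$, let $0\le p_i\le n-1$ for $i=1,\dots,k$, $\vec p=(p_1,\dots,p_k)$, and let $(J,\vec f)=(J,f_1,\dots,f_k)\in\mathcal Y_{\vec p}$. Consider the moment map $\mu_{\mathcal J,\vec p}$ restricted to the orbit space $$\mathcal O_{J,\vec f}=\Big(\prod_{i=0}^k\mathrm{Ham}^{\mathbb C}_{J_i}(X_i,\omega_i)\Big)\cdot(J,f_1,\dots,f_k).$$ Then $\mu_{\mathcal J,\vec p}=0$ has a solution in $\mathcal O_{J,\vec f}$ if and only if the system $$\begin{cases}\displaystyle\sum_{i=1}^k\frac{f_i^*\omega_{i,\varphi_i}^{p_i+1}}{(p_i+1)!}\wedge\frac{\omega_{0,\varphi_0}^{n-p_i-1}}{(n-p_i-1)!}-\mathrm{Ric}(\omega_{0,\varphi_0},J)\wedge\frac{\omega_{0,\varphi_0}^{n-1}}{(n-1)!}-c_0\frac{\omega_{0,\varphi_0}^n}{n!}=0,\\[2mm] \displaystyle\frac{\omega_{0,\varphi_0}^{n-p_j}}{(n-p_j)!}\wedge\frac{f_j^*\omega_{j,\varphi_j}^{p_j}}{p_j!}-c_j\frac{f_j^*\omega_{j,\varphi_j}^n}{n!}=0,\qquad j=1,\dots,k,\end{cases}$$ has a solution $(\varphi_0,\dots,\varphi_k)\in\prod_{i=0}^k\mathrm{Ham}^{\mathbb C}_{J_i}(X_i,\omega_i)$. In particular, if $X_0=\cdots=X_k$, $f_1=\cdots=f_k=\mathrm{id}$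 and $\vec p=(0,\dots,0)$, this system is the coupled cscK equation with the Kähler classes fixed, namely $$\sum_{i=1}^k\omega_{i,\varphi_i}\wedge\frac{\omega_{0,\varphi_0}^{n-1}}{(n-1)!}-\mathrm{Ric}(\omega_{0,\varphi_0},J)\wedge\frac{\omega_{0,\varphi_0}^{n-1}}{(n-1)!}=c_0\frac{\omega_{0,\varphi_0}^n}{n!},\qquad \omega_{0,\varphi_0}^n=c_j\,\omega_{j,\varphi_j}^n\ \ (j=1,\dots,k).$$
   Context: For a symplectic manifold $(X,\omega)$, $\mathcal J(X,\omega)$ is the space of integrable almost complex structures $J$ with $\omega(J\cdot,J\cdot)=\omega(\cdot,\cdot)$ and $\omega(\cdot,J\cdot)>0$. For a diffeomorphism $f$, $J^f:=Df\,J\,Df^{-1}$ and $f_*=(f^{-1})^*$ on forms. Put $$\mathcal Z_{\vec p}=\prod_{i=1}^k\{f_i\in\mathrm{Diffeo}(X_0,X_i)\mid\omega_0^{n-p_i}\wedge f_i^*\omega_i^{p_i}>0\},$$ $$\mathcal Y_{\vec p}=\{(J,f_1,\dots,f_k)\in\mathcal J(X_0,\omega_0)\times\mathcal Z_{\vec p}\mid J^{f_i}\in\mathcal J(X_i,\omega_i),\ i=1,\dots,k\}.$$ Given $(J,\vec f)\in\mathcal Y_{\vec p}$, set $J_0=J$, $J_i=J^{f_i}$. For a complex structure $J$ on $X$, $\mathrm{Ham}^{\mathbb C}_J(X,\omega)$ is the set (not a group) of diffeomorphisms $\varphi$ of $X$ with $\varphi^*\omega=\omega+\sqrt{-1}\,\partial_J\bar\partial_J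 h>0$ for some $h\in C^\infty(X,\mathbb R)$; we write $\omega_{i,\varphi_i}=\varphi_i^*\omega_i$. Tuples of diffeomorphisms act by $$(\sigma_0,\dots,\sigma_k)\cdot(J,f_1,\dots,f_k)=(D\sigma_0JD\sigma_0^{-1},\ \sigma_1\circ f_1\circ\sigma_0^{-1},\dots,\sigma_k\circ f_k\circ\sigma_0^{-1}).$$ $\mathrm{Ric}(\omega,J)$ is the Ricci form of the Kähler structure $(\omega,J)$. The map $\mu_{\mathcal J,\vec p}$ takes values in $\mathrm{Lie}(\prod_{i=0}^k\mathrm{Ham}(X_i,\omega_i))^*$, represented by tuples of top-degree forms on $X_0,\dots,X_k$ (paired with Hamiltonian functions by integration). The component on $X_0$ of $\mu_{\mathcal J,\vec p}(J,f_1,\dots,f_k)$ is $$c_0\frac{\omega_0^n}{n!}-\sum_{i=1}^k\frac{f_i^*\omega_i^{p_i+1}}{(p_i+1)!}\wedge\frac{\omega_0^{n-p_i-1}}{(n-p_i-1)!}+\mathrm{Ric}(\omega_0,J)\wedge\frac{\omega_0^{n-1}}{(n-1)!},$$ and its component on $X_j$ ($1\le j\le k$) is $$c_j\frac{\omega_j^n}{n!}-\frac{(f_j)_*\omega_0^{n-p_j}}{(n-p_j)!}\wedge\frac{\omega_j^{p_j}}{p_j!}.$$ The constants $c_0,\dots,c_k$ are the normalizing constants for which each component integrates to zero; they are constant on the orbit and are the same constants as in the system. *)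

(* Defs.v *)
From HB Require Import structures.
From mathcomp Require Import all_boot all_order all_algebra.
From mathcomp Require Import all_classical all_reals all_analysis.
From mathcomp.real_closed Require Import complex.

Set Implicit Arguments.
Unset Strict Implicit.
Unset Printing Implicit Defensive.

Import Order.TTheory GRing.Theory Num.Theory.
Import numFieldNormedType.Exports.

Local Open Scope classical_set_scope.
Local Open Scope ring_scope.

(** * Smooth manifolds *)

Section Smooth.
Context {R : realType} {V W : normedModType R}.

(* [class_Ck] and [smooth_on] are meant for open sets [U]. *)
Fixpoint class_Ck (k : nat) (U : set V) (f : V -> W) : Prop :=
  match k with
  | 0 => forall y, U y -> {for y, continuous f}
  | k'.+1 => (forall y, U y -> differentiable f y) /\
             (forall v, class_Ck k' U (fun y => 'D_v f y))
  end.

Definition smooth_on (U : set V) (f : V -> W) := forall k, class_Ck k U f.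

End Smooth.

Record chart (R : realType) (m : nat) (T : topologicalType) := Chart {
  dom : set T;
  fwd : T -> 'rV[R]_m;
  bwd : 'rV[R]_m -> T;
  dom_open : open dom;
  im_open : open (fwd @` dom);
  fwdK : forall x, dom x -> bwd (fwd x) = x;
  fwd_cont : forall x, dom x -> {for x, continuous fwd};
  bwd_cont : forall y, (fwd @` dom) y -> {for y, continuous bwd} }.

Definition im {R : realType} {m : nat} {T : topologicalType}
  (c : chart R m T) : set 'rV[R]_m := fwd c @` dom c.

Definition transition_smooth {R : realType} {m : nat} {T : topologicalType}
  (c d : chart R m T) : Prop :=
  smooth_on (fwd c @` (dom c `&` dom d)) (fwd d \o bwd c).

Record manifold (R : realType) (m : nat) := Manifold {
  msort :> topologicalType;
  atlas : set (chart R m msort);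
  msort_hausdorff : hausdorff_space msort;
  atlas_cover : forall x : msort, exists c, atlas c /\ dom c x;
  (* pairwise smooth compatibility together with maximality *)
  atlas_maximal : forall c, atlas c <->
    (forall d, atlas d -> transition_smooth c d /\ transition_smooth d c) }.

(** * Tangent vectors

   The tangent space at [x] is identified with ['rV[R]_m] by means of a chart
   [chart_at x] around [x], chosen once and for all; derivatives of maps between
   manifolds are read in these charts. *)

Section Tangent.
Context {R : realType} {m : nat}.
Implicit Types X Y Z : manifold R m.

Definition chart_at X (x : X) : chart R m X := projT1 (cid (atlas_cover x)).

Definition tderiv X Y (f : X -> Y) (x : X) : 'rV[R]_m -> 'rV[R]_m :=
  'd (fwd (chart_at (f x)) \o f \o bwd (chart_at x)) (fwd (chart_at x) x).

(* the derivatives, at [x] and at [y], of [fwd c] and of [bwd c] *)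
Definition to_chart X (c : chart R m X) (x : X) : 'rV[R]_m -> 'rV[R]_m :=
  'd (fwd c \o bwd (chart_at x)) (fwd (chart_at x) x).

Definition of_chart X (c : chart R m X) (y : 'rV[R]_m) : 'rV[R]_m -> 'rV[R]_m :=
  'd (fwd (chart_at (bwd c y)) \o bwd c) y.

Definition smooth_map X Y (f : X -> Y) : Prop :=
  continuous f /\
  forall c d, atlas c -> atlas d ->
    smooth_on (fwd c @` (dom c `&` f @^-1` dom d)) (fwd d \o f \o bwd c).

Definition smooth_fun X (h : X -> R) : Prop :=
  forall c, atlas c -> smooth_on (im c) (h \o bwd c).

Record bimap X Y := Bimap {
  bimap_fun :> X -> Y;
  bimap_inv : Y -> X;
  bimapK : cancel bimap_fun bimap_inv;
  bimapVK : cancel bimap_inv bimap_fun }.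

Definition biid X : bimap X X :=
  Bimap (fun x : X => erefl (id x)) (fun x : X => erefl (id x)).

Definition biinv X Y (f : bimap X Y) : bimap Y X :=
  Bimap (bimapVK f) (bimapK f).

Definition bicomp X Y Z (g : bimap Y Z) (f : bimap X Y) : bimap X Z :=
  Bimap (can_comp (bimapK g) (bimapK f)) (can_comp (bimapVK f) (bimapVK g)).

Definition is_diffeo X Y (f : bimap X Y) : Prop :=
  smooth_map f /\ smooth_map (biinv f).

End Tangent.

(** * Differential forms

   A form takes a point and a list of tangent vectors; a form of degree [d]
   vanishes on lists of length other than [d]. *)

Section Forms.
Context {R : realType} {m : nat}.
Implicit Types X Y : manifold R m.

Definition dform X := X -> seq 'rV[R]_m -> R^o.

Definition local X (c : chart R m X) (a : dform X)
  (y : 'rV[R]_m) (vs : seq 'rV[R]_m) : R :=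
  a (bwd c y) (map (of_chart c y) vs).

Definition is_form X (d : nat) (a : dform X) : Prop :=
  [/\ forall x vs, size vs != d -> a x vs = 0,
      forall x s t (r : R) v w,
        a x (s ++ (r *: v + w) :: t) = r * a x (s ++ v :: t) + a x (s ++ w :: t),
      forall x s t u v, a x (s ++ v :: t ++ v :: u) = 0 &
      forall c, atlas c -> forall vs,
        smooth_on (im c) (fun y => local c a y vs)].

Definition ext_d (a : 'rV[R]_m -> seq 'rV[R]_m -> R)
  (y : 'rV[R]_m) (vs : seq 'rV[R]_m) : R :=
  \sum_(i < size vs)
    (-1) ^+ i * 'D_(nth 0 vs i) (fun z => a z (take i vs ++ drop i.+1 vs)) y.

Definition closed_form X (a : dform X) : Prop :=
  forall c, atlas c -> forall y, im c y -> forall vs, ext_d (local c a) y vs = 0.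

Definition pullback X Y (f : X -> Y) (a : dform Y) : dform X :=
  fun x vs => a (f x) (map (tderiv f x) vs).

(* number of pairs [i < j] with [b_i = false] and [b_j = true] *)
Fixpoint shuffle_inv (b : seq bool) : nat :=
  if b is b0 :: b' then
    ((if b0 then 0 else count id b') + shuffle_inv b')%N
  else 0%N.

(* The sum runs over all ways of dealing [vs] into two ordered sublists, so that
   (a /\ b)(v, w) = a(v) b(w) - a(w) b(v) for 1-forms. *)
Definition wedge X (a b : dform X) : dform X := fun x vs =>
  \sum_(t : (size vs).-tuple bool)
    (-1) ^+ shuffle_inv t * (a x (mask t vs) * b x (mask (map negb t) vs)).

Definition form1 X : dform X := fun x vs => (nilp vs)%:R.

Definition fpow X (a : dform X) (k : nat) : dform X := iter k (wedge a) (@form1 X).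

Definition divfact X (k : nat) (a : dform X) : dform X := (k`!%:R : R)^-1 *: a.

Definition std_basis : seq 'rV[R]_m := [seq delta_mx 0 i | i <- enum 'I_m].

End Forms.

(* Iterated integral; used below on compactly supported continuous functions. *)
Fixpoint integral_rV (R : realType) (m : nat) : ('rV[R]_m -> R) -> R :=
  match m with
  | 0 => fun g => g 0
  | m'.+1 => fun g =>
      \int[lebesgue_measure]_t
        integral_rV (fun w : 'rV[R]_m' => g (row_mx (t%:M : 'rV[R]_1) w))
  end.

(* [has_integral vol a I]: the integral of the top-degree form [a] over the
   compact manifold [X] oriented by the nowhere vanishing top-degree form [vol]
   is [I], as computed with some partition of unity. The sign of [vol] corrects
   for charts that reverse the orientation. *)
Definition has_integral {R : realType} {m : nat} (X : manifold R m)
  (vol a : dform X) (I : R) : Prop :=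
  exists (N : nat) (c : 'I_N -> chart R m X) (rho : 'I_N -> X -> R),
    [/\ forall l, atlas (c l),
        forall l, smooth_fun (rho l) /\ (forall x, 0 <= rho l x),
        forall l, closure [set x | rho l x != 0] `<=` dom (c l),
        forall x, \sum_(l < N) rho l x = 1 &
        I = \sum_(l < N) integral_rV
              ((fun y => rho l (bwd (c l) y) *
                         (Num.sg (local (c l) vol y std_basis) *
                          local (c l) a y std_basis)) \_ (im (c l)))].

(** * The model space C^n

   ['rV[R]_(n + n)] is C^n with coordinates [(x_1, .., x_n, y_1, .., y_n)] and
   [z_a = x_a + i y_a]. *)

Section Cn.
Context {R : realType} {n : nat}.
Let E := 'rV[R]_(n + n).

Definition Jstd (v : E) : E := row_mx (- rsubmx v) (lsubmx v).

Definition ex (a : 'I_n) : E := delta_mx 0 (lshift n a).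
Definition ey (a : 'I_n) : E := delta_mx 0 (rshift n a).

Definition dz (a : 'I_n) (v : E) : R[i] :=
  Complex (v 0 (lshift n a)) (v 0 (rshift n a)).

(* d^2 u / dz_a dzbar_b
   = 1/4 (d/dx_a - i d/dy_a) (d/dx_b + i d/dy_b) u *)
Definition levi (u : E -> R) (y : E) (a b : 'I_n) : R[i] :=
  let D2 v w := 'D_v (fun z => 'D_w u z) y in
  Complex ((D2 (ex a) (ex b) + D2 (ey a) (ey b)) / 4)
          ((D2 (ex a) (ey b) - D2 (ey a) (ex b)) / 4).

(* i * sum_(a, b) (d^2 u / dz_a dzbar_b) dz_a /\ dzbar_b, which is real because
   the matrix [levi u y] is Hermitian for smooth [u] *)
Definition i_ddbar_std (u : E -> R) (y : E) (vs : seq E) : R :=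
  if vs is [:: v; w] then
    complex.Re (Complex 0 1 * \sum_(a < n) \sum_(b < n) levi u y a b *
      (dz a v * conjc (dz b w) - dz a w * conjc (dz b v)))
  else 0.

End Cn.

(** * Complex and Kähler structures *)

Section Kahler.
Context {R : realType} {n : nat}.
Implicit Types X Y : manifold R (n + n).

Definition endo X := X -> 'rV[R]_(n + n) -> 'rV[R]_(n + n).

Definition holo_chart X (J : endo X) (c : chart R (n + n) X) : Prop :=
  atlas c /\
  forall y, im c y -> forall v,
    to_chart c (bwd c y) (J (bwd c y) (of_chart c y v)) = Jstd v.

Definition almost_complex X (J : endo X) : Prop :=
  [/\ forall x (r : R) v w, J x (r *: v + w) = r *: J x v + J x w,
      forall x v, J x (J x v) = - v &
      forall c, atlas c -> forall v, smooth_on (im c)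
        (fun y => to_chart c (bwd c y) (J (bwd c y) (of_chart c y v)))].

Definition integrable_acs X (J : endo X) : Prop :=
  almost_complex J /\ forall x : X, exists c, holo_chart J c /\ dom c x.

Definition positive X (J : endo X) (w : dform X) : Prop :=
  forall x v, v != 0 -> 0 < w x [:: v; J x v].

Definition symplectic X (w : dform X) : Prop :=
  [/\ is_form 2 w, closed_form w &
      forall x v, (forall u, w x [:: v; u] = 0) -> v = 0].

(* J(X, omega) *)
Definition compatible_cs X (w : dform X) : set (endo X) :=
  [set J | [/\ integrable_acs J,
               forall x u v, w x [:: J x u; J x v] = w x [:: u; v] &
               positive J w]].

Definition compact_kahler X (w : dform X) : Prop :=
  [/\ compact [set: X], symplectic w & exists J, compatible_cs w J].

(* The form whose expression in every holomorphic chart [c] is [F c]. The two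
   families [F] used below agree on overlaps of holomorphic charts, so that such
   a form exists, and it is unique because these charts cover [X]. *)
Definition glue_holo X (J : endo X)
  (F : chart R (n + n) X -> 'rV[R]_(n + n) -> seq 'rV[R]_(n + n) -> R) :
  dform X :=
  xget 0 [set b : dform X | forall c, holo_chart J c ->
            forall y, im c y -> local c b y = F c y].

(* sqrt(-1) * del_J delbar_J h *)
Definition i_ddbar X (J : endo X) (h : X -> R) : dform X :=
  glue_holo J (fun c => i_ddbar_std (h \o bwd c)).

(* Ric = - sqrt(-1) del delbar log(omega^n), where omega^n is read as a density
   with respect to Lebesgue measure in holomorphic coordinates. This density is
   a constant multiple of det(g_(a bbar)); the absolute value absorbs the sign
   of the real ordering (x_1, .., x_n, y_1, .., y_n) of the coordinates. *)
Definition Ric X (w : dform X) (J : endo X) : dform X :=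
  glue_holo J (fun c y vs =>
    - i_ddbar_std (fun z => ln `|local c (fpow w n) z std_basis|) y vs).

(* J^f = Df J Df^-1 *)
Definition pushJ X Y (f : bimap X Y) (J : endo X) : endo Y :=
  fun y v => tderiv f (bimap_inv f y)
               (J (bimap_inv f y) (tderiv (bimap_inv f) y v)).

Definition HamC X (J : endo X) (w : dform X) : set (bimap X X) :=
  [set phi | is_diffeo phi /\ exists h : X -> R,
     [/\ smooth_fun h, pullback phi w = w + i_ddbar J h &
         positive J (pullback phi w)]].

End Kahler.

(** * The moment map and the coupled system

   The manifold of index 0 is kept apart from those of index 1, .., k, which are
   indexed by ['I_k]. *)

Section Coupled.
Context {R : realType} {n k : nat} (p : 'I_k -> nat).
Context {X0 : manifold R (n + n)} {X : 'I_k -> manifold R (n + n)}.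
Variables (w0 : dform X0) (w : forall i, dform (X i)).
Arguments w : clear implicits.

Definition config : Type := (endo X0 * (forall i, bimap X0 (X i)))%type.

(* positivity of a top-degree form for the orientation given by w0^n *)
Definition positive_top (a : dform X0) : Prop :=
  forall x vs, 0 < fpow w0 n x vs -> 0 < a x vs.

Definition Z_space : set (forall i, bimap X0 (X i)) :=
  [set f | forall i, is_diffeo (f i) /\
     positive_top (wedge (fpow w0 (n - p i)) (pullback (f i) (fpow (w i) (p i))))].

Definition Y_space : set config :=
  [set P | [/\ compatible_cs w0 P.1, Z_space P.2 &
               forall i, compatible_cs (w i) (pushJ (P.2 i) P.1)]].

Definition act (s0 : bimap X0 X0) (s : forall i, bimap (X i) (X i))
  (P : config) : config :=
  (pushJ s0 P.1, fun i => bicomp (s i) (bicomp (P.2 i) (biinv s0))).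

Definition in_HamC (P : config)
  (s0 : bimap X0 X0) (s : forall i, bimap (X i) (X i)) : Prop :=
  HamC P.1 w0 s0 /\ forall i, HamC (pushJ (P.2 i) P.1) (w i) (s i).

Definition orbit_space (P : config) : set config :=
  [set Q | exists s0 s, in_HamC P s0 s /\ Q = act s0 s P].

Definition mu0 (c0 : R) (P : config) : dform X0 :=
  c0 *: divfact n (fpow w0 n)
  - \sum_(i < k) wedge
      (divfact (p i).+1 (pullback (P.2 i) (fpow (w i) (p i).+1)))
      (divfact (n - p i - 1) (fpow w0 (n - p i - 1)))
  + wedge (Ric w0 P.1) (divfact (n - 1) (fpow w0 (n - 1))).

Definition mu_ (c : 'I_k -> R) (P : config) (j : 'I_k) : dform (X j) :=
  c j *: divfact n (fpow (w j) n)
  - wedge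
      (divfact (n - p j) (pullback (bimap_inv (P.2 j)) (fpow w0 (n - p j))))
      (divfact (p j) (fpow (w j) (p j))).

Arguments mu_ : clear implicits.

Definition mu_zero (c0 : R) (c : 'I_k -> R) (P : config) : Prop :=
  mu0 c0 P = 0 /\ forall j, mu_ c P j = 0.

Definition normalized (c0 : R) (c : 'I_k -> R) (P : config) : Prop :=
  has_integral (fpow w0 n) (mu0 c0 P) 0 /\
  forall j, has_integral (fpow (w j) n) (mu_ c P j) 0.

Definition coupled_system (c0 : R) (c : 'I_k -> R) (P : config)
  (s0 : bimap X0 X0) (s : forall i, bimap (X i) (X i)) : Prop :=
  let w0s := pullback s0 w0 in
  let ws i := pullback (s i) (w i) in
  \sum_(i < k) wedge
      (divfact (p i).+1 (pullback (P.2 i) (fpow (ws i) (p i).+1)))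
      (divfact (n - p i - 1) (fpow w0s (n - p i - 1)))
  - wedge (Ric w0s P.1) (divfact (n - 1) (fpow w0s (n - 1)))
  - c0 *: divfact n (fpow w0s n) = 0
  /\
  forall j,
    wedge (divfact (n - p j) (fpow w0s (n - p j)))
          (divfact (p j) (pullback (P.2 j) (fpow (ws j) (p j))))
    - c j *: divfact n (pullback (P.2 j) (fpow (ws j) n)) = 0.

End Coupled.

Definition coupled_cscK {R : realType} {n k : nat} {X : manifold R (n + n)}
  (w0 : dform X) (w : 'I_k -> dform X) (J : endo X) (c0 : R) (c : 'I_k -> R)
  (s0 : bimap X X) (s : 'I_k -> bimap X X) : Prop :=
  let w0s := pullback s0 w0 in
  let ws i := pullback (s i) (w i) in
  \sum_(i < k) wedge (ws i) (divfact (n - 1) (fpow w0s (n - 1)))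
  - wedge (Ric w0s J) (divfact (n - 1) (fpow w0s (n - 1)))
  = c0 *: divfact n (fpow w0s n)
  /\
  forall j, fpow w0s n = c j *: fpow (ws j) n.

(* Main.v *)
(* Pulling the component of the moment map on X_0 at the orbit point
   (s_0, .., s_k).(J, f) back by s_0, and its component on X_j back by s_j o f_j,
   turns it into minus the corresponding equation of the system: pullback is
   functorial and multiplicative, and Ric(s_0^* w_0, J) = s_0^* Ric(w_0, J^(s_0)).
   Since s_0 and s_j o f_j are diffeomorphisms, one vanishes if and only if the
   other does. *)

Require Import Defs.
From mathcomp Require Import all_boot all_order all_algebra.
From mathcomp Require Import all_classical all_reals all_analysis.

Set Implicit Arguments.
Unset Strict Implicit.
Unset Printing Implicit Defensive.

Import Order.TTheory GRing.Theory Num.Theory.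
Import numFieldNormedType.Exports.

Local Open Scope classical_set_scope.
Local Open Scope ring_scope.

(** A differential depends only on the germ of the map: the first-order expansion of [f] at [x] is
    also one of [g], and [diff_unique] concludes. Chart expressions of a composite agree only near a
    point, hence this form. *)
Lemma near_eq_diff (R : realType) (V W : normedModType R) (f g : V -> W) x :
  {near x, f =1 g} -> differentiable f x ->
  differentiable g x /\ 'd g x = 'd f x :> (V -> W).
Proof.
move=> fg df; have fgx : f x = g x := nbhs_singleton fg.
have dg : g \o shift x = cst (g x) + 'd f x +o_ 0 id.
  have /eqaddoP fo := diff_locally df.
  apply/eqaddoP => e e0; have {fo} := fo e e0.
  rewrite -fgx; have : \forall y \near x, f y = g y := fg.
  (* The little-o is taken in the increment, so the neighbourhood of [x] is translated to one of
     0. *)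
  rewrite (near_shift 0 x) subr0.
  by apply: filterS2 => h /= fgh; rewrite !fctE /= -fgh.
have gE := diff_unique (diff_continuous df) dg.
by split => //; apply/diff_locallyP; rewrite gE; split => //; exact: diff_continuous.
Qed.

(** * Differentials read in charts and the chain rule *)

Section Charts.
Context {R : realType} {m : nat}.
Implicit Types X Y Z : manifold R m.

Definition chart_map X Y (c : chart R m X) (d : chart R m Y) (f : X -> Y) :=
  fwd d \o f \o bwd c.

(** [tderiv] is the case of the charts [chart_at], while [to_chart] and [of_chart] are cases of
    [f = id]; one chain rule serves all three. *)
Definition chart_diff X Y (c : chart R m X) (d : chart R m Y) (f : X -> Y) x :
  'rV[R]_m -> 'rV[R]_m := 'd (chart_map c d f) (fwd c x).

(* Enough for the chain rule; unlike for [smooth_map], stability under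
   composition does not require the higher-order chain rule. *)
Definition chart_diffble X Y (f : X -> Y) : Prop :=
  continuous f /\
  forall c d x, atlas c -> atlas d -> dom c x -> dom d (f x) ->
    differentiable (chart_map c d f) (fwd c x).

Lemma smooth_map_diffble X Y (f : X -> Y) : smooth_map f -> chart_diffble f.
Proof.
move=> [fc fs]; split => // c d x ac ad cx dfx.
by have [H _] := fs c d ac ad 1; apply: H; exists x.
Qed.

Lemma im_fwd X (c : chart R m X) x : dom c x -> im c (fwd c x).
Proof. by move=> cx; exists x. Qed.

Lemma dom_bwd X (c : chart R m X) y : im c y -> dom c (bwd c y).
Proof. by move=> [x cx <-]; rewrite fwdK. Qed.

Lemma bwdK X (c : chart R m X) y : im c y -> fwd c (bwd c y) = y.
Proof. by move=> [x cx <-]; rewrite fwdK. Qed.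

Lemma near_dom X Y (c : chart R m X) (f : X -> Y) (U : set Y) x :
  continuous f -> open U -> dom c x -> U (f x) ->
  \forall y \near fwd c x, U (f (bwd c y)).
Proof.
move=> fc oU cx Ux.
have bc : {for fwd c x, continuous (bwd c)} by apply: bwd_cont; exact: im_fwd.
have /(continuous_comp bc) : {for bwd c (fwd c x), continuous f} by exact: fc.
by apply; rewrite /= fwdK //; exact: open_nbhs_nbhs.
Qed.

Lemma near_im X (c : chart R m X) y : im c y -> \forall z \near y, im c z.
Proof. by move=> cy; apply: open_nbhs_nbhs; split => //; exact: im_open. Qed.

(** In two charts the identity is their transition map, so this is the compatibility of the
    atlas. *)
Lemma id_diffble X : chart_diffble (@id X).
Proof.
split; first by move=> ?; exact: cvg_id.
move=> c d x ac ad cx dx.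
have [+ _] := (atlas_maximal c).1 ac d ad; move=> /(_ 1)[H _].
by apply: H; exists x.
Qed.

(** The middle chart cancels only where [f] lands in [dom d], since [bwd d \o fwd d] is arbitrary
    elsewhere; by continuity this happens near [fwd c x]. *)
Lemma chart_map_comp X Y Z (f : X -> Y) (g : Y -> Z) (c : chart R m X)
    (d : chart R m Y) (e : chart R m Z) x :
  continuous f -> dom c x -> dom d (f x) ->
  {near fwd c x, chart_map d e g \o chart_map c d f =1 chart_map c e (g \o f)}.
Proof.
move=> fc cx dfx; have := near_dom fc (dom_open d) cx dfx.
by apply: filterS => y dy; rewrite /chart_map /= fwdK.
Qed.

Lemma chart_diffble_comp X Y Z (f : X -> Y) (g : Y -> Z) (c : chart R m X)
    (d : chart R m Y) (e : chart R m Z) x :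
  chart_diffble f -> chart_diffble g -> atlas c -> atlas d -> atlas e ->
  dom c x -> dom d (f x) -> dom e (g (f x)) ->
  differentiable (chart_map c e (g \o f)) (fwd c x) /\
  chart_diff c e (g \o f) x = chart_diff d e g (f x) \o chart_diff c d f x.
Proof.
move=> [fc fd] [_ gd] ac ad ae cx dfx egx.
(* The chain rule differentiates the second factor at the value of the first; [E] identifies that
   value with the coordinate of [f x]. *)
have E : chart_map c d f (fwd c x) = fwd d (f x) by rewrite /chart_map /= fwdK.
have Df : differentiable (chart_map c d f) (fwd c x) by exact: fd.
have Dg : differentiable (chart_map d e g) (chart_map c d f (fwd c x)).
  by rewrite E; exact: gd.
have [D DE] := near_eq_diff (chart_map_comp g e fc cx dfx)
  (differentiable_comp Df Dg).
split; first exact: D.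
by rewrite /chart_diff -E -(diff_comp Df Dg); exact: DE.
Qed.

Lemma chart_at_atlas X (x : X) : atlas (chart_at x).
Proof. by rewrite /chart_at; case: cid => c []. Qed.

Lemma dom_chart_at X (x : X) : dom (chart_at x) x.
Proof. by rewrite /chart_at; case: cid => c []. Qed.

Lemma chart_diff_comp X Y Z (f : X -> Y) (g : Y -> Z) (c : chart R m X)
    (d : chart R m Y) (e : chart R m Z) x :
  chart_diffble f -> chart_diffble g -> atlas c -> atlas d -> atlas e ->
  dom c x -> dom d (f x) -> dom e (g (f x)) ->
  chart_diff c e (g \o f) x = chart_diff d e g (f x) \o chart_diff c d f x.
Proof. by move=> *; exact: (chart_diffble_comp _ _ _ _ _ _ _ _).2. Qed.

Lemma diffble_comp X Y Z (f : X -> Y) (g : Y -> Z) :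
  chart_diffble f -> chart_diffble g -> chart_diffble (g \o f).
Proof.
move=> C1f C1g; split.
  by move=> x; apply: continuous_comp; [exact: C1f.1|exact: C1g.1].
move=> c e x ac ae cx egx.
by have [] := chart_diffble_comp C1f C1g ac (chart_at_atlas (f x)) ae cx
  (dom_chart_at _) egx.
Qed.

Lemma chart_diff_id X (c : chart R m X) x :
  dom c x -> chart_diff c c id x = id.
Proof.
move=> cx.
have E : {near fwd c x, id =1 chart_map c c id}.
  by have := near_im (im_fwd cx); apply: filterS => y cy; rewrite /chart_map /= bwdK.
have Did : is_diff (fwd c x) id id by exact: is_diff_id.
have [_ DE] := near_eq_diff E (@ex_diff _ _ _ _ _ _ _ Did).
by rewrite /chart_diff DE (@diff_val _ _ _ _ _ _ _ Did).
Qed.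

Lemma tderivE X Y (f : X -> Y) x :
  tderiv f x = chart_diff (chart_at x) (chart_at (f x)) f x.
Proof. by []. Qed.

Lemma to_chartE X (c : chart R m X) x :
  to_chart c x = chart_diff (chart_at x) c id x.
Proof. by []. Qed.

Lemma of_chartE X (c : chart R m X) y : im c y ->
  of_chart c y = chart_diff c (chart_at (bwd c y)) id (bwd c y).
Proof. by move=> cy; rewrite /chart_diff bwdK. Qed.

Lemma tderiv_comp X Y Z (f : X -> Y) (g : Y -> Z) x :
  chart_diffble f -> chart_diffble g ->
  tderiv (g \o f) x = tderiv g (f x) \o tderiv f x.
Proof.
move=> C1f C1g; rewrite !tderivE.
by apply: chart_diff_comp => //; (exact: chart_at_atlas || exact: dom_chart_at).
Qed.

Lemma tderiv_id X (x : X) : tderiv id x = id.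
Proof. by rewrite tderivE chart_diff_id //; exact: dom_chart_at. Qed.

(** * Pullback and the algebra of forms *)

Lemma pullback_comp X Y Z (f : X -> Y) (g : Y -> Z) (a : dform Z) :
  chart_diffble f -> chart_diffble g ->
  pullback (g \o f) a = pullback f (pullback g a).
Proof.
move=> C1f C1g; apply/funext => x; apply/funext => vs.
by rewrite /pullback tderiv_comp // map_comp.
Qed.

Lemma pullback_id X (a : dform X) : pullback id a = a.
Proof.
apply/funext => x; apply/funext => vs.
by rewrite /pullback tderiv_id map_id.
Qed.

Lemma pullback_wedge X Y (f : X -> Y) (a b : dform Y) :
  pullback f (wedge a b) = wedge (pullback f a) (pullback f b).
Proof.
apply/funext => x; apply/funext => vs; rewrite /pullback /wedge.
rewrite size_map; apply: eq_bigr => t _; congr (_ * (a _ _ * b _ _)).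
  by rewrite map_mask.
by rewrite map_mask.
Qed.

Lemma pullback_fpow X Y (f : X -> Y) (a : dform Y) k :
  pullback f (fpow a k) = fpow (pullback f a) k.
Proof.
elim: k => [|k IHk] /=.
  by apply/funext => x; apply/funext => -[].
by rewrite /fpow /= pullback_wedge IHk.
Qed.

Lemma pullback_sum X Y (f : X -> Y) (I : Type) (r : seq I) (F : I -> dform Y) :
  pullback f (\sum_(i <- r) F i) = \sum_(i <- r) pullback f (F i).
Proof. by elim/big_rec2: _ => // i a b _ <-. Qed.

Lemma pullbackD X Y (f : X -> Y) (a b : dform Y) :
  pullback f (a + b) = pullback f a + pullback f b.
Proof. by []. Qed.

Lemma pullbackN X Y (f : X -> Y) (a : dform Y) : pullback f (- a) = - pullback f a.
Proof. by []. Qed.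

Lemma pullbackZ X Y (f : X -> Y) r (a : dform Y) :
  pullback f (r *: a) = r *: pullback f a.
Proof. by []. Qed.

Lemma pullback_divfact X Y (f : X -> Y) k (a : dform Y) :
  pullback f (divfact k a) = divfact k (pullback f a).
Proof. by []. Qed.

Lemma pullback_bimapK X Y (f : bimap X Y) (a : dform Y) :
  chart_diffble f -> chart_diffble (bimap_inv f) ->
  pullback (bimap_inv f) (pullback f a) = a.
Proof.
move=> C1f C1g.
rewrite -pullback_comp // (_ : f \o bimap_inv f = id) ?pullback_id //.
by apply/funext => x /=; exact: bimapVK.
Qed.

Lemma pullback_eq0 X Y (f : bimap X Y) (a : dform Y) :
  chart_diffble f -> chart_diffble (bimap_inv f) ->
  pullback f a = 0 <-> a = 0.
Proof.
move=> C1f C1g; split=> [a0|->//].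
by rewrite -(pullback_bimapK a C1f C1g) a0.
Qed.

(** Only dealing every vector to [a] contributes: [form1] kills the other terms, and this one has no
    inversion. It simplifies the powers 0 and 1 when p = 0. *)
Lemma wedge_form1r X (a : dform X) : wedge a (@form1 _ _ X) = a.
Proof.
apply/funext => x; apply/funext => vs; rewrite /wedge.
have H s : all id s -> shuffle_inv s = 0%N by elim: s => //= -[].
rewrite (bigD1 [tuple of nseq (size vs) true]) //= big1 => [|t tE].
  rewrite H ?all_nseq ?orbT // expr0 mul1r mask_true // map_nseq mask_false.
  by rewrite /form1 mulr1 addr0.
rewrite /form1 (_ : nilp _ = false) ?mulr0 //.
apply/negbTE; apply: contra tE; rewrite /nilp size_mask ?size_map ?size_tuple //.
rewrite count_map; move=> t0; apply/eqP/val_inj => /=.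
rewrite -[in RHS](size_tuple t); apply/all_pred1P.
move: t0; rewrite -leqn0 leqNgt -has_count -all_predC.
by apply: sub_all => -[].
Qed.

End Charts.

(** * Transport of charts along a diffeomorphism *)

Section PushChart.
Context {R : realType} {m : nat} {X Y : manifold R m}.
Variables (f : bimap X Y) (hf : is_diffeo f) (c : chart R m X).

Let dom_push : set Y := bimap_inv f @^-1` dom c.
Let fwd_push : Y -> 'rV[R]_m := fwd c \o bimap_inv f.
Let bwd_push : 'rV[R]_m -> Y := f \o bwd c.

Let push_dom_open : open dom_push.
Proof.
by apply: open_comp (dom_open c) => y _; have [_ [h _]] := hf; exact: h.
Qed.

Lemma push_imE : fwd_push @` dom_push = im c.
Proof.
apply/seteqP; split => [_ [y dy <-]|_ [x dx <-]]; first by exists (bimap_inv f y).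
by exists (f x); rewrite /dom_push /fwd_push /= bimapK.
Qed.

Let push_im_open : open (fwd_push @` dom_push).
Proof. by rewrite push_imE; exact: im_open. Qed.

Let push_fwdK y : dom_push y -> bwd_push (fwd_push y) = y.
Proof. by move=> dy; rewrite /bwd_push /fwd_push /= fwdK // bimapVK. Qed.

Let push_fwd_cont y : dom_push y -> {for y, continuous fwd_push}.
Proof.
move=> dy; apply: continuous_comp; first by have [_ [h _]] := hf; exact: h.
exact: fwd_cont.
Qed.

Let push_bwd_cont y :
  (fwd_push @` dom_push) y -> {for y, continuous bwd_push}.
Proof.
rewrite push_imE => cy; apply: continuous_comp; first exact: bwd_cont.
by have [[h _] _] := hf; exact: h.
Qed.

(** The chart c o f^-1. In it a form on [Y] has the expression that its pullback has in [c], which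
    makes locally defined objects natural. *)
Definition push_chart : chart R m Y :=
  Chart push_dom_open push_im_open push_fwdK push_fwd_cont push_bwd_cont.

Lemma im_push_chart : im push_chart = im c.
Proof. exact: push_imE. Qed.

(** By maximality of the atlas it suffices that the transition maps are smooth, and these are chart
    expressions of [f] and of its inverse. *)
Lemma push_chart_atlas : atlas c -> atlas push_chart.
Proof.
move=> ac; apply/(atlas_maximal push_chart).2 => d ad.
have [[_ sf] [_ sg]] := hf; split; last exact: sg d c ad ac.
have := sf c d ac ad; rewrite /transition_smooth; congr (smooth_on _ _).
apply/seteqP; split => [_ [x [cx dx] <-]|_ [y [cy dy] <-]].
  by exists (f x); rewrite /= ?/dom_push ?/fwd_push /= bimapK.
by exists (bimap_inv f y); rewrite //= bimapVK.
Qed.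

(** The new chart has [bwd] equal to [f \o bwd c], so this is the chain rule through
    [chart_at (bwd c y)]. *)
Lemma of_push_chart y : atlas c -> im c y ->
  of_chart push_chart y = tderiv f (bwd c y) \o of_chart c y.
Proof.
move=> ac cy; have [/smooth_map_diffble C1f _] := hf.
transitivity (chart_diff c (chart_at (f (bwd c y))) f (bwd c y)).
  by rewrite /chart_diff bwdK.
rewrite (of_chartE cy).
exact: (chart_diff_comp (id_diffble X) C1f ac
  (chart_at_atlas _) (chart_at_atlas _) (dom_bwd cy) (dom_chart_at _) (dom_chart_at _)).
Qed.

Lemma local_push_chart (a : dform Y) y : atlas c -> im c y ->
  local push_chart a y = local c (pullback f a) y.
Proof.
move=> ac cy; apply/funext => vs.
by rewrite /local /pullback of_push_chart // map_comp.
Qed.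

(** Precomposing [fwd] of the new chart with [f] cancels the inverse and leaves [fwd c]. *)
Lemma to_push_chart x v : atlas c -> dom c x ->
  to_chart push_chart (f x) (tderiv f x v) = to_chart c x v.
Proof.
move=> ac cx; have [/smooth_map_diffble C1f _] := hf.
have pf : dom push_chart (f x) by rewrite /= /dom_push /= bimapK.
have E := chart_diff_comp C1f (id_diffble Y)
  (chart_at_atlas x) (chart_at_atlas (f x)) (push_chart_atlas ac)
  (dom_chart_at x) (dom_chart_at (f x)) pf.
transitivity (chart_diff (chart_at x) push_chart (id \o f) x v).
  by rewrite E.
rewrite to_chartE /chart_diff; congr ('d _ _ v); apply/funext => z.
by rewrite /chart_map /= /fwd_push /= bimapK.
Qed.

End PushChart.

(** * Locality of the model operator *)

Section Ddbar.
Context {R : realType} {n : nat}.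

Lemma near_eq_i_ddbar_std (u v : 'rV[R]_(n + n) -> R) y :
  {near y, u =1 v} -> i_ddbar_std u y = i_ddbar_std v y.
Proof.
move=> uv.
have D2 a b : 'D_a (fun z => 'D_b u z) y = 'D_a (fun z => 'D_b v z) y.
  apply: near_eq_derive.
  (* The outer derivative sees the inner one around [y], so the functions must agree near each [z]
     close to [y], not only at it. *)
  have : \forall z \near y, \forall t \near z, u t = v t by exact: nbhs_interior.
  by apply: filterS => z uvz; exact: near_eq_derive.
have levi_eq : levi u y = levi v y.
  by apply/funext => i; apply/funext => j; rewrite /levi !D2.
by rewrite /i_ddbar_std levi_eq.
Qed.

End Ddbar.

(** * Gluing in holomorphic charts and naturality of the Ricci form *)

Section Glue.
Context {R : realType} {n : nat}.
Implicit Types X Y : manifold R (n + n).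

Lemma tderivVK X Y (f : bimap X Y) : is_diffeo f ->
  forall x v, tderiv (bimap_inv f) (f x) (tderiv f x v) = v.
Proof.
move=> [/smooth_map_diffble C1f /smooth_map_diffble C1g] x v.
rewrite -[LHS]/((_ \o tderiv f x) v) -tderiv_comp //.
rewrite (_ : _ \o _ = id) ?tderiv_id //.
by apply/funext => z; exact: bimapK.
Qed.

Lemma is_diffeo_inv X Y (f : bimap X Y) : is_diffeo f -> is_diffeo (biinv f).
Proof. by move=> [? ?]; split. Qed.

Lemma pushJ_inv X Y (f : bimap X Y) (J : endo X) : is_diffeo f ->
  pushJ (biinv f) (pushJ f J) = J.
Proof.
move=> hf; apply/funext => x; apply/funext => v.
by rewrite /pushJ /= bimapK tderivVK // tderivVK.
Qed.

Lemma holo_push_chart X Y (f : bimap X Y) (hf : is_diffeo f) (J : endo X) c :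
  holo_chart J c -> holo_chart (pushJ f J) (push_chart hf c).
Proof.
move=> [ac hc]; split; first exact: push_chart_atlas.
move=> y; rewrite im_push_chart => cy v; rewrite /pushJ of_push_chart //=.
by rewrite bimapK tderivVK // to_push_chart ?hc //; exact: dom_bwd.
Qed.

(** The property by which [glue_holo] selects its form, kept apart from the choice. *)
Definition glued X (J : endo X)
    (F : chart R (n + n) X -> 'rV[R]_(n + n) -> seq 'rV[R]_(n + n) -> R)
    (b : dform X) :=
  forall c, holo_chart J c -> forall y, im c y -> local c b y = F c y.

(** Integrability provides a holomorphic chart around each point, and its local expression
    determines the form because [of_chart] is onto there. *)
Lemma glued_uniq X (J : endo X) F (a b : dform X) :
  integrable_acs J -> glued J F a -> glued J F b -> a = b.
Proof.
move=> [_ hJ] Fa Fb; apply/funext => x; apply/funext => vs.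
have [c [hc cx]] := hJ x; have [ac _] := hc.
have E : map (of_chart c (fwd c x)) (map (to_chart c x) vs) = vs.
  rewrite -map_comp of_chartE; last exact: im_fwd.
  rewrite fwdK // -(chart_diff_comp (id_diffble X) (id_diffble X)
    (chart_at_atlas x) ac (chart_at_atlas x) (dom_chart_at x) cx (dom_chart_at x)).
  by rewrite chart_diff_id ?map_id //; exact: dom_chart_at.
have := congr1 (fun g => g (map (to_chart c x) vs))
  (etrans (Fa c hc _ (im_fwd cx)) (esym (Fb c hc _ (im_fwd cx)))).
by rewrite /local E fwdK.
Qed.

(** Holomorphic charts of J push forward to holomorphic charts of J^f, so it is enough to compare
    [G] with [F] on pushed charts. *)
Lemma glued_pullback X Y (f : bimap X Y) (hf : is_diffeo f) (J : endo X) F G b :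
  (forall c y, holo_chart J c -> im c y -> G (push_chart hf c) y = F c y) ->
  glued (pushJ f J) G b -> glued J F (pullback f b).
Proof.
move=> GF Gb c hc y cy; have [ac _] := hc.
rewrite -(local_push_chart hf) // Gb ?GF ?im_push_chart //.
exact: holo_push_chart.
Qed.

Definition Ric_local X (w : dform X) (c : chart R (n + n) X)
    (y : 'rV[R]_(n + n)) (vs : seq 'rV[R]_(n + n)) : R :=
  - i_ddbar_std (fun z => ln `|local c (fpow w n) z std_basis|) y vs.

Lemma Ric_local_push X Y (f : bimap X Y) (hf : is_diffeo f) (w : dform Y) c y :
  atlas c -> im c y ->
  Ric_local w (push_chart hf c) y = Ric_local (pullback f w) c y.
Proof.
move=> ac cy; apply/funext => vs; apply: (congr1 (fun g => - g vs)).
(* The log densities are compared on the open set [im c], a neighbourhood of [y]. *)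
apply: near_eq_i_ddbar_std; have := near_im cy; apply: filterS => z cz.
by rewrite local_push_chart // pullback_fpow.
Qed.

(* No existence of the Ricci form is needed: the pullback matches the forms with
   the prescribed local expressions on both sides, hence also the default [0]. *)
Lemma pullback_Ric X Y (f : bimap X Y) (w : dform Y) (J : endo X) :
  is_diffeo f -> integrable_acs J ->
  pullback f (Ric w (pushJ f J)) = Ric (pullback f w) J.
Proof.
move=> hf iJ; have hg := is_diffeo_inv hf.
have down b : glued (pushJ f J) (Ric_local w) b ->
    glued J (Ric_local (pullback f w)) (pullback f b).
  apply: (glued_pullback (hf := hf)) => c y [ac _] cy.
  exact: Ric_local_push.
have up b : glued J (Ric_local (pullback f w)) b ->
    glued (pushJ f J) (Ric_local w) (pullback (bimap_inv f) b).
  (* Writing [J] as the push of J^f by the inverse diffeomorphism lets the same transport lemma run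
     backwards. *)
  rewrite -{1}(pushJ_inv J hf); apply: (glued_pullback (hf := hg)) => c y [ac _] cy.
  rewrite (Ric_local_push hg _ ac cy).
  have [/smooth_map_diffble C1f /smooth_map_diffble C1g] := hf.
  congr (Ric_local _ c y); exact: pullback_bimapK.
(* If both forms exist, uniqueness applies; [down] and [up] exclude that exactly one exists. *)
rewrite /Ric /glue_holo; case: xgetP => [b _ /= Gb|noG].
  case: xgetP => [b' _ /= Gb'|]; first exact: glued_uniq (down _ Gb) Gb'.
  by move=> /(_ _ (down _ Gb)).
by case: xgetP => // b' _ /= /up /noG.
Qed.

End Glue.

(** * Components of the moment map along the orbit *)

Section Orbit.
Context {R : realType} {n k : nat} (p : 'I_k -> nat).
Context {X0 : manifold R (n + n)} {X : 'I_k -> manifold R (n + n)}.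
Variables (w0 : dform X0) (w : forall i, dform (X i)).
Arguments w : clear implicits.
Variables (J : endo X0) (f : forall i, bimap X0 (X i)).
Variables (s0 : bimap X0 X0) (s : forall i, bimap (X i) (X i)).
Hypotheses (hJ : integrable_acs J) (hf : forall i, is_diffeo (f i)).
Hypotheses (hs0 : is_diffeo s0) (hs : forall i, is_diffeo (s i)).

(** The orbit point has i-th map s_i f_i s_0^-1, and precomposing it with s_0 leaves s_i f_i. *)
Lemma pullback_act i (a : dform (X i)) :
  pullback s0 (pullback ((act s0 s (J, f)).2 i) a) =
  pullback (f i) (pullback (s i) a).
Proof.
have [/smooth_map_diffble f1 _] := hf i; have [/smooth_map_diffble s1 _] := hs i.
have [/smooth_map_diffble s01 /smooth_map_diffble s0V1] := hs0.
rewrite -(pullback_comp a s01 (diffble_comp (diffble_comp s0V1 f1) s1)).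
rewrite -(pullback_comp a f1 s1); congr (pullback _ a).
by apply/funext => x /=; rewrite bimapK.
Qed.

(** The inverse map s_0 f_i^-1 s_i^-1, taken after s_i f_i, leaves s_0. *)
Lemma pullback_act_inv i (a : dform X0) :
  pullback (bicomp (s i) (f i)) (pullback (bimap_inv ((act s0 s (J, f)).2 i)) a) =
  pullback s0 a.
Proof.
have [/smooth_map_diffble f1 /smooth_map_diffble fV1] := hf i.
have [/smooth_map_diffble s1 /smooth_map_diffble sV1] := hs i.
have [/smooth_map_diffble s01 _] := hs0.
rewrite -(pullback_comp a (diffble_comp f1 s1)
  (diffble_comp (diffble_comp sV1 fV1) s01)).
by congr (pullback _ a); apply/funext => x /=; rewrite !bimapK.
Qed.

Lemma mu_zero_act c0 (c : 'I_k -> R) :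
  mu_zero p w0 w c0 c (act s0 s (J, f)) <->
  coupled_system p w0 w c0 c (J, f) s0 s.
Proof.
have eq0N (Y : manifold R (n + n)) (a b : dform Y) : a = - b -> a = 0 <-> b = 0.
  by move=> ->; split=> [/eqP|->]; rewrite ?oppr0 // oppr_eq0 => /eqP.
have [s01 s0V1] : chart_diffble s0 /\ chart_diffble (bimap_inv s0).
  by have [/smooth_map_diffble ? /smooth_map_diffble ?] := hs0.
have H1 : pullback s0 (mu0 p w0 w c0 (act s0 s (J, f))) =
  - (\sum_(i < k) wedge
      (divfact (p i).+1 (pullback (f i) (fpow (pullback (s i) (w i)) (p i).+1)))
      (divfact (n - p i - 1) (fpow (pullback s0 w0) (n - p i - 1)))
  - wedge (Ric (pullback s0 w0) J) (divfact (n - 1) (fpow (pullback s0 w0) (n - 1)))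
  - c0 *: divfact n (fpow (pullback s0 w0) n)).
  rewrite /mu0 2!pullbackD pullbackN pullback_sum pullback_wedge.
  (* The complex structure of the orbit point is [pushJ s0 J]; naturality trades it for [J] together
     with the pulled back form. *)
  rewrite (pullback_Ric w0 hs0 hJ) pullbackZ !pullback_divfact !pullback_fpow.
  rewrite (eq_bigr (fun i => wedge
    (divfact (p i).+1 (pullback (f i) (fpow (pullback (s i) (w i)) (p i).+1)))
    (divfact (n - p i - 1) (fpow (pullback s0 w0) (n - p i - 1)))))
    => [|i _]; last first.
    rewrite pullback_wedge !pullback_divfact pullback_act.
    by rewrite (pullback_fpow (s i)) (pullback_fpow s0).
  by rewrite !opprB addrA addrAC.
have H2 j : pullback (bicomp (s j) (f j)) (mu_ p w0 w c (act s0 s (J, f)) (j := j)) =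
  - (wedge (divfact (n - p j) (fpow (pullback s0 w0) (n - p j)))
       (divfact (p j) (pullback (f j) (fpow (pullback (s j) (w j)) (p j))))
     - c j *: divfact n (pullback (f j) (fpow (pullback (s j) (w j)) n))).
  have [/smooth_map_diffble f1 _] := hf j; have [/smooth_map_diffble s1 _] := hs j.
  rewrite /mu_ pullbackD pullbackN pullback_wedge pullbackZ !pullback_divfact.
  rewrite pullback_act_inv !(pullback_comp _ f1 s1).
  by rewrite !(pullback_fpow (s j)) (pullback_fpow s0) opprB.
rewrite /mu_zero /coupled_system /=.
split=> -[E0 E]; split.
- by apply/(eq0N _ _ _ H1).1; rewrite E0.
- by move=> j; apply/(eq0N _ _ _ (H2 j)).1; rewrite E.
(* Vanishing descends from the pullback because [s0] is invertible; the same is done below with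
   [bicomp (s j) (f j)]. *)
- by apply/(pullback_eq0 _ s01 s0V1)/(eq0N _ _ _ H1).
move=> j; have [/smooth_map_diffble f1 /smooth_map_diffble fV1] := hf j.
have [/smooth_map_diffble s1 /smooth_map_diffble sV1] := hs j.
apply/(pullback_eq0 (f := bicomp (s j) (f j)) _
  (diffble_comp f1 s1) (diffble_comp sV1 fV1)).
exact/(eq0N _ _ _ (H2 j)).
Qed.

End Orbit.

Theorem theorem1p7 (R : realType) (n k : nat) (hn : (0 < n)%N) :
  (forall (p : 'I_k -> nat) (hp : forall i, (p i <= n - 1)%N)
     (X0 : manifold R (n + n)) (X : 'I_k -> manifold R (n + n))
     (w0 : dform X0) (w : forall i, dform (X i))
     (hw0 : compact_kahler w0) (hw : forall i, compact_kahler (w i))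
     (J : endo X0) (f : forall i, bimap X0 (X i))
     (hY : Y_space p w0 w (J, f))
     (c0 : R) (c : 'I_k -> R) (hc : normalized p w0 w c0 c (J, f)),
     (exists Q, orbit_space w0 w (J, f) Q /\ mu_zero p w0 w c0 c Q) <->
     (exists (s0 : bimap X0 X0) (s : forall i, bimap (X i) (X i)),
        in_HamC w0 w (J, f) s0 s /\
        coupled_system p w0 w c0 c (J, f) s0 s))
  /\
  (forall (X : manifold R (n + n)) (w0 : dform X) (w : 'I_k -> dform X)
     (hw0 : compact_kahler w0) (hw : forall i, compact_kahler (w i))
     (J : endo X)
     (hY : Y_space (fun=> 0%N) w0 w (J, fun=> biid X))
     (c0 : R) (c : 'I_k -> R)
     (hc : normalized (fun=> 0%N) w0 w c0 c (J, fun=> biid X))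
     (s0 : bimap X X) (s : 'I_k -> bimap X X)
     (hs : in_HamC w0 w (J, fun=> biid X) s0 s),
     coupled_system (fun=> 0%N) w0 w c0 c (J, fun=> biid X) s0 s <->
     coupled_cscK w0 w J c0 c s0 s).

Proof.
split=> [p hp X0 X w0 w hw0 hw J f hY c0 c hc|X w0 w hw0 hw J hY c0 c hc s0 s hs].
  have [[hJ _ _] hf _] := hY.
  have orbitP s0 s : in_HamC w0 w (J, f) s0 s ->
      mu_zero p w0 w c0 c (act s0 s (J, f)) <->
      coupled_system p w0 w c0 c (J, f) s0 s.
    (* The maps in [HamC] are diffeomorphisms by definition, and those in [f] are so by
       [Z_space]. *)
    move=> [[hs0 _] hs]; apply: mu_zero_act => // i; first exact: (hf i).1.
    exact: (hs i).1.
  split=> [[_ [[s0 [s [hs ->]]] /(orbitP _ _ hs)]]|[s0 [s [hs]]]].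
    by exists s0, s.
  by move=> /(orbitP _ _ hs) Q0; exists (act s0 s (J, f)); split => //; exists s0, s.
have fpow1 (a : dform X) : fpow a 1 = a by exact: wedge_form1r.
have divfact1 (a : dform X) : divfact 1 a = a by rewrite /divfact invr1 scale1r.
have divfact0 (a : dform X) : divfact 0 a = a by rewrite /divfact invr1 scale1r.
(* With p_j = 0 both terms of the equation of index j carry 1/n!, which is cancelled as a nonzero
   scalar. *)
have n0 : (n`!%:R : R)^-1 != 0 by rewrite invr_eq0 pnatr_eq0 -lt0n fact_gt0.
rewrite /coupled_system /coupled_cscK /=.
have E0 : \sum_(i < k) wedge
    (divfact 1 (pullback id (fpow (pullback (s i) (w i)) 1)))
    (divfact (n - 0 - 1) (fpow (pullback s0 w0) (n - 0 - 1))) =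
  \sum_(i < k) wedge (pullback (s i) (w i))
    (divfact (n - 1) (fpow (pullback s0 w0) (n - 1))).
  by apply: eq_bigr => i _; rewrite pullback_id fpow1 divfact1 subn0.
(* The power 0 is [form1], a right unit, so the wedge collapses to the n-th power divided by n!. *)
have E1 j : wedge (divfact (n - 0) (fpow (pullback s0 w0) (n - 0)))
      (divfact 0 (pullback id (fpow (pullback (s j) (w j)) 0)))
    - c j *: divfact n (pullback id (fpow (pullback (s j) (w j)) n)) =
  (n`!%:R : R)^-1 *: (fpow (pullback s0 w0) n - c j *: fpow (pullback (s j) (w j)) n).
  rewrite !pullback_id divfact0 subn0 wedge_form1r /divfact scalerBr.
  by congr (_ - _); rewrite !scalerA mulrC.
rewrite E0; split=> -[H0 H]; split.
- by move/eqP: H0; rewrite subr_eq0 => /eqP.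
- move=> j; have /eqP := H j; rewrite E1 scaler_eq0 (negbTE n0) subr_eq0.
  by move/eqP.
- by rewrite H0 subrr.
by move=> j; rewrite (E1 j) (H j) subrr scaler0.
Qed.
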